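(* Let $W\in\mathbb{R}^{m\times n}$ have full row rank and let $\{(\mathbf{u}^k,\mathbf{y}^k)\}$ be the bounded sequence generated by Algorithm A (described in the context). Let $t=\max_k\{t_k\}$, $\rho\ge\max\{t,1\}$, and suppose that for some constant $c>0$ and all $k$ $$\begin{aligned}t_k\ge\max\Big\{&4\Big(\|W^{\top}(W^{\top})^{\dagger}(A^{\top}A+\beta W^{\top}W)\|+\|W^{\top}W\|\,\|W^{\dagger}\|^2\,\|A^{\top}A+\beta W^{\top}W\|\\&+\big(\|A^{\top}A+\beta W^{\top}W\|+1\big)\|W^{\dagger}\|^2\,\|A^{\top}A+\beta W^{\top}W\|\Big),\ c\Big\}.\end{aligned}$$ Then every limit point $(\mathbf{u}^*,\mathbf{y}^* )$ of $\{(\mathbf{u}^k,\mathbf{y}^k)\}$ is a KKT point of the problem $$\min_{\mathbf{u}\in\mathbb{R}^n,\ \mathbf{y}\in\mathbb{R}^m}\ f(\mathbf{u})+\lambda\|\mathbf{y}\|_0+\tfrac{\beta}{2}\|W\mathbf{u}\|^2\quad\text{s.t.}\quad\mathbf{y}=W\mathbf{u}.$$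
   Context: Data: $A\in\mathbb{R}^{p\times n}$, $\mathbf{u}_0\in\mathbb{R}^p$, $f(\mathbf{u})=\frac12\|A\mathbf{u}-\mathbf{u}_0\|^2$, constants $\lambda,\beta,\rho>0$ and $t_k>0$. $\|\cdot\|$ is the Euclidean norm of vectors and the spectral norm of matrices, $\|\mathbf{y}\|_0$ is the number of nonzero entries of $\mathbf{y}$, and $\dagger$ denotes the Moore–Penrose pseudoinverse. $\mathbf{z}(\mathbf{u})=(W^{\top})^{\dagger}(-\nabla f(\mathbf{u})-\beta W^{\top}W\mathbf{u})$. Algorithm A: choose $\mathbf{u}^0\in\mathbb{R}^n$, set $\mathbf{y}^0=W\mathbf{u}^0$, $\mathbf{z}^0=\mathbf{z}(\mathbf{u}^0)$. For $k=0,1,2,\dots$: (1) $\mathbf{u}^{k+1}=\operatorname{argmin}_{\mathbf{u}\in\mathbb{R}^n}\{f(\mathbf{u})+\langle W\mathbf{u}-\mathbf{y}^k,\mathbf{z}^k\rangle+\frac{\beta}{2}\|W\mathbf{u}\|^2+\frac{t_k}{2}\|\mathbf{u}-\mathbf{u}^k\|^2+\frac{\rho}{2}\|W\mathbf{u}-\mathbf{y}^k\|^2\}$; (2) $\mathbf{z}^{k+1}=\mathbf{z}(\mathbf{u}^{k+1})$ and $\mathbf{y}^{k+1}\in\operatorname{argmin}_{\mathbf{y}\in\mathbb{R}^m}\{\lambda\|\mathbf{y}\|_0+\langle W\mathbf{u}^{k+1}-\mathbf{y},\mathbf{z}^{k+1}\rangle+\frac{t_k}{2}\|\mathbf{y}-\mathbf{y}^k\|^2+\frac{\rho}{2}\|W\mathbf{u}^{k+1}-\mathbf{y}\|^2\}$.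 KKT point: $(\mathbf{u},\mathbf{y})$ is a KKT point of the problem if there exists $\mathbf{z}\in\mathbb{R}^m$ such that $\mathbf{0}=\nabla f(\mathbf{u})+\beta W^{\top}W\mathbf{u}+W^{\top}\mathbf{z}$, $\mathbf{0}\in\partial(\lambda\|\mathbf{y}\|_0)-\mathbf{z}$, and $W\mathbf{u}-\mathbf{y}=\mathbf{0}$, where $\partial(\lambda\|\mathbf{y}\|_0)$ is the (limiting) subdifferential, equal to the set of $\mathbf{r}\in\mathbb{R}^m$ with $r_i=0$ whenever $y_i\ne0$ (and $r_i\in\mathbb{R}$ arbitrary whenever $y_i=0$). *)

(* Defs.v *)
From HB Require Import structures.
From mathcomp Require Import all_boot all_order all_algebra.
From mathcomp Require Import all_classical all_reals all_analysis.

Set Implicit Arguments.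
Unset Strict Implicit.
Unset Printing Implicit Defensive.

Import Order.TTheory GRing.Theory Num.Theory.
Import numFieldNormedType.Exports.

Local Open Scope classical_set_scope.
Local Open Scope ring_scope.

Definition edot (R : realType) (n : nat) (x y : 'cV[R]_n) : R :=
  \sum_(i < n) x i 0 * y i 0.

(* The library norm on matrices is the max norm, not the Euclidean one; both
   induce the same topology, so limits and neighbourhoods below are the
   library ones. *)
Definition enorm (R : realType) (n : nat) (x : 'cV[R]_n) : R :=
  Num.sqrt (\sum_(i < n) x i 0 ^+ 2).

Definition specnorm (R : realType) (m n : nat) (M : 'M[R]_(m, n)) : R :=
  sup [set enorm (M *m x) | x in [set x : 'cV[R]_n | enorm x <= 1]].

Definition l0norm (R : realType) (m : nat) (y : 'cV[R]_m) : nat :=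
  #|[set i : 'I_m | y i 0 != 0]%SET|.

Definition penrose (R : realType) (m n : nat)
    (M : 'M[R]_(m, n)) (X : 'M[R]_(n, m)) : Prop :=
  [/\ M *m X *m M = M, X *m M *m X = X,
      (M *m X)^T = M *m X & (X *m M)^T = X *m M].

(* The Penrose conditions have exactly one solution, so the default value 0 of
   [xget] is never used. The library's [pinvmx] is only a generalized inverse,
   not the Moore-Penrose one. *)
Definition mpinv (R : realType) (m n : nat) (M : 'M[R]_(m, n)) : 'M[R]_(n, m) :=
  xget 0 [set X | penrose M X].

Definition gradient (R : realType) (n : nat) (f : 'cV[R]_n -> R)
    (u : 'cV[R]_n) : 'cV[R]_n :=
  \col_(i < n) 'D_(delta_mx i 0) f u.

Definition argmin (R : realType) (T : Type) (F : T -> R) : set T :=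
  [set x | forall y, F x <= F y].

(* liminf_(x -> y, x != y) (g x - g y - <r, x - y>) / |x - y| >= 0 *)
Definition frechet_subdifferential (R : realType) (m : nat)
    (g : 'cV[R]_m -> R) (y : 'cV[R]_m) : set 'cV[R]_m :=
  [set r | forall e : R, 0 < e ->
     \forall x \near y, - (e * enorm (x - y)) <= g x - g y - edot r (x - y)].

Definition limiting_subdifferential (R : realType) (m : nat)
    (g : 'cV[R]_m -> R) (y : 'cV[R]_m) : set 'cV[R]_m :=
  [set r | exists (v s : nat -> 'cV[R]_m),
     [/\ v @ \oo --> y, (g (v j)) @[j --> \oo] --> g y,
         forall j, frechet_subdifferential g (v j) (s j) & s @ \oo --> r]].

Definition lsq (R : realType) (p n : nat) (A : 'M[R]_(p, n)) (b : 'cV[R]_p)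
    (u : 'cV[R]_n) : R :=
  2^-1 * enorm (A *m u - b) ^+ 2.

Definition zmap (R : realType) (p m n : nat) (A : 'M[R]_(p, n)) (b : 'cV[R]_p)
    (W : 'M[R]_(m, n)) (beta : R) (u : 'cV[R]_n) : 'cV[R]_m :=
  mpinv W^T *m (- gradient (lsq A b) u - beta *: (W^T *m W *m u)).

Definition u_objective (R : realType) (p m n : nat) (A : 'M[R]_(p, n))
    (b : 'cV[R]_p) (W : 'M[R]_(m, n)) (beta rho tk : R)
    (uk : 'cV[R]_n) (yk zk : 'cV[R]_m) (u : 'cV[R]_n) : R :=
  lsq A b u + edot (W *m u - yk) zk + beta / 2 * enorm (W *m u) ^+ 2
  + tk / 2 * enorm (u - uk) ^+ 2 + rho / 2 * enorm (W *m u - yk) ^+ 2.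

Definition y_objective (R : realType) (m n : nat) (W : 'M[R]_(m, n))
    (lam rho tk : R) (u1 : 'cV[R]_n) (yk z1 : 'cV[R]_m) (y : 'cV[R]_m) : R :=
  lam * (l0norm y)%:R + edot (W *m u1 - y) z1
  + tk / 2 * enorm (y - yk) ^+ 2 + rho / 2 * enorm (W *m u1 - y) ^+ 2.

Definition generated_by_algorithm (R : realType) (p m n : nat)
    (A : 'M[R]_(p, n)) (b : 'cV[R]_p) (W : 'M[R]_(m, n)) (lam beta rho : R)
    (t_ : nat -> R) (u : nat -> 'cV[R]_n) (y : nat -> 'cV[R]_m) : Prop :=
  y 0%N = W *m u 0%N /\
  exists z : nat -> 'cV[R]_m,
    z 0%N = zmap A b W beta (u 0%N) /\
    forall k : nat,
      [/\ argmin (u_objective A b W beta rho (t_ k) (u k) (y k) (z k)) (u k.+1),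
          z k.+1 = zmap A b W beta (u k.+1) &
          argmin (y_objective W lam rho (t_ k) (u k.+1) (y k) (z k.+1))
            (y k.+1)].

(* KKT points of
     min f(u) + lam |y|_0 + beta/2 |W u|^2  subject to  y = W u,
   where f = lsq A b. *)
Definition KKT_point (R : realType) (p m n : nat) (A : 'M[R]_(p, n))
    (b : 'cV[R]_p) (W : 'M[R]_(m, n)) (lam beta : R)
    (u : 'cV[R]_n) (y : 'cV[R]_m) : Prop :=
  exists z : 'cV[R]_m,
    [/\ 0 = gradient (lsq A b) u + beta *: (W^T *m W *m u) + W^T *m z,
        [set r - z | r in limiting_subdifferential
                            (fun x : 'cV[R]_m => lam * (l0norm x)%:R) y] 0 &
        W *m u - y = 0].

(* Main.v *)
(** Write g(u) = H u - A^T u0 for the gradient of the smooth part, with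
    H = A^T A + beta W^T W, and M = (W^T)^+, so that M W^T = 1 and
    z(u) = - M g(u). Applying M to the optimality condition of the u-step gives
      rho (W u' - y) = - M (H + t_k) (u' - u),
    while z' - z = - M H (u' - u). Hence the only term by which
    the augmented Lagrangian can grow, <W u' - y, z' - z>, is at most
    (t_k / 4) |u' - u|^2, because rho >= t_k, rho >= 1 and t_k dominates
    4 (|H| + 1) |M|^2 |H|. The augmented Lagrangian thus decreases by a multiple
    of |u' - u|^2 + |y' - y|^2; being bounded below along a bounded sequence, it
    forces u' - u, y' - y and W u' - y' to tend to 0, and the residuals of the
    optimality conditions of both steps tend to 0 with them. All these residuals
    are continuous in (u, y), so they vanish at every limit point. *)

Require Import Defs.
From mathcomp Require Import all_boot all_order all_algebra.
From mathcomp Require Import all_classical all_reals all_analysis.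
From mathcomp Require Import ring lra.

Set Implicit Arguments.
Unset Strict Implicit.
Unset Printing Implicit Defensive.

Import Order.TTheory GRing.Theory Num.Theory.
Import numFieldNormedType.Exports.

Local Open Scope classical_set_scope.
Local Open Scope ring_scope.

(** * Euclidean inner product and norm *)

Lemma edotC (R : realType) (n : nat) (x y : 'cV[R]_n) : edot x y = edot y x.
Proof. by apply: eq_bigr => i _; rewrite mulrC. Qed.

Lemma edotDl (R : realType) (n : nat) (x y z : 'cV[R]_n) :
  edot (x + y) z = edot x z + edot y z.
Proof. by rewrite -big_split; apply: eq_bigr => i _; rewrite mxE mulrDl. Qed.

Lemma edotZl (R : realType) (n : nat) (a : R) (x y : 'cV[R]_n) :
  edot (a *: x) y = a * edot x y.
Proof. by rewrite mulr_sumr; apply: eq_bigr => i _; rewrite mxE mulrA. Qed.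

Lemma edotNl (R : realType) (n : nat) (x y : 'cV[R]_n) :
  edot (- x) y = - edot x y.
Proof. by rewrite -scaleN1r edotZl mulN1r. Qed.

Lemma edotDr (R : realType) (n : nat) (x y z : 'cV[R]_n) :
  edot x (y + z) = edot x y + edot x z.
Proof. by rewrite edotC edotDl !(edotC x). Qed.

Lemma edotZr (R : realType) (n : nat) (a : R) (x y : 'cV[R]_n) :
  edot x (a *: y) = a * edot x y.
Proof. by rewrite edotC edotZl edotC. Qed.

Lemma edotNr (R : realType) (n : nat) (x y : 'cV[R]_n) :
  edot x (- y) = - edot x y.
Proof. by rewrite edotC edotNl edotC. Qed.

Lemma edot_mulmxl (R : realType) (m n : nat) (M : 'M[R]_(m, n))
    (x : 'cV[R]_n) (y : 'cV[R]_m) : edot (M *m x) y = edot x (M^T *m y).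
Proof.
rewrite /edot.
under eq_bigr => i _ do rewrite mxE mulr_suml.
rewrite exchange_big /=; apply: eq_bigr => j _.
rewrite mxE mulr_sumr; apply: eq_bigr => i _.
by rewrite mxE mulrCA mulrA.
Qed.

Lemma edot_delta (R : realType) (n : nat) (x : 'cV[R]_n) (i : 'I_n) :
  edot x (delta_mx i 0) = x i 0.
Proof.
rewrite /edot (bigD1 i) //= mxE !eqxx mulr1 big1 ?addr0// => j ji.
by rewrite mxE (negbTE ji) mulr0.
Qed.

Lemma enorm_sqr (R : realType) (n : nat) (x : 'cV[R]_n) :
  enorm x ^+ 2 = edot x x.
Proof.
rewrite sqr_sqrtr; last by apply: sumr_ge0 => i _; exact: sqr_ge0.
by apply: eq_bigr => i _; rewrite expr2.
Qed.

Lemma enorm_ge0 (R : realType) (n : nat) (x : 'cV[R]_n) : 0 <= enorm x.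
Proof. exact: sqrtr_ge0. Qed.

Lemma enorm0 (R : realType) (n : nat) : enorm (0 : 'cV[R]_n) = 0.
Proof. by rewrite /enorm big1 ?sqrtr0// => i _; rewrite mxE expr0n. Qed.

Lemma enormZ (R : realType) (n : nat) (a : R) (x : 'cV[R]_n) :
  enorm (a *: x) = `|a| * enorm x.
Proof.
apply/eqP; rewrite -(@eqrXn2 _ 2) ?mulr_ge0 ?enorm_ge0//.
by rewrite exprMn !enorm_sqr edotZl edotZr mulrA real_normK ?num_real// expr2.
Qed.

Lemma enormD_sqr (R : realType) (n : nat) (x y : 'cV[R]_n) :
  enorm (x + y) ^+ 2 = enorm x ^+ 2 + 2 * edot x y + enorm y ^+ 2.
Proof. by rewrite !enorm_sqr !(edotDl, edotDr) (edotC y x); ring. Qed.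

Lemma normr_coord_le_enorm (R : realType) (n : nat) (x : 'cV[R]_n) (i : 'I_n) :
  `|x i 0| <= enorm x.
Proof.
rewrite -ler_sqr ?nnegrE ?enorm_ge0// real_normK ?num_real//.
rewrite enorm_sqr /edot (bigD1 i) //= -expr2 lerDl.
by apply: sumr_ge0 => j _; rewrite -expr2 sqr_ge0.
Qed.

Lemma enorm_eq0 (R : realType) (n : nat) (x : 'cV[R]_n) :
  enorm x = 0 -> x = 0.
Proof.
move=> x0; apply/colP => i; rewrite mxE; apply/eqP.
by rewrite -normr_le0 -x0 normr_coord_le_enorm.
Qed.

(** Cauchy-Schwarz: expand the square of the norm of |y| x - |x| y and cancel |x| |y|, the case of a
    zero vector being apart. *)
Lemma edot_le_enorm (R : realType) (n : nat) (x y : 'cV[R]_n) :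
  edot x y <= enorm x * enorm y.
Proof.
have edot0 (z : 'cV[R]_n) : edot 0 z = 0.
  by rewrite -(scale0r (0 : 'cV[R]_n)) edotZl mul0r.
have [x0|x0] := eqVneq (enorm x) 0.
  by rewrite (enorm_eq0 x0) edot0 enorm0 mul0r.
have [y0|y0] := eqVneq (enorm y) 0.
  by rewrite (enorm_eq0 y0) edotC edot0 enorm0 mulr0.
have xy_gt0 : 0 < enorm x * enorm y.
  by rewrite mulr_gt0 // lt_neqAle enorm_ge0 eq_sym ?x0 ?y0.
have := sqr_ge0 (enorm (enorm y *: x - enorm x *: y)).
rewrite enormD_sqr -scaleNr !enormZ edotZl edotZr normrN.
rewrite !ger0_norm ?enorm_ge0//.
rewrite -[_ <= enorm x * _](ler_pM2l xy_gt0); lra.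
Qed.

(** Each x_i^2 is at most |x_i| times the whole sum. *)
Lemma enorm_sum (R : realType) (n : nat) (x : 'cV[R]_n) :
  enorm x <= \sum_(i < n) `|x i 0|.
Proof.
have s0 : 0 <= \sum_(i < n) `|x i 0| by apply: sumr_ge0.
rewrite -ler_sqr ?nnegrE ?enorm_ge0// enorm_sqr expr2 mulr_suml.
apply: ler_sum => i _; apply: (le_trans (ler_norm _)).
rewrite normrM ler_wpM2l// (bigD1 i)//= lerDl.
by apply: sumr_ge0.
Qed.

(** * Spectral norm *)

(** This makes the [sup] in [specnorm] a genuine supremum rather than a default value. *)
Lemma specnorm_has_ubound (R : realType) (m n : nat) (M : 'M[R]_(m, n)) :
  has_ubound [set enorm (M *m x) | x in [set x : 'cV[R]_n | enorm x <= 1]].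
Proof.
exists (\sum_i \sum_j `|M i j|) => _ [v /= v1 <-].
apply: (le_trans (enorm_sum _)); apply: ler_sum => i _.
rewrite mxE; apply: (le_trans (ler_norm_sum _ _ _)).
apply: ler_sum => j _; rewrite normrM ler_piMr//.
exact: le_trans (normr_coord_le_enorm _ _) v1.
Qed.

Lemma specnorm_ge0 (R : realType) (m n : nat) (M : 'M[R]_(m, n)) :
  0 <= specnorm M.
Proof.
apply: (ub_le_sup (specnorm_has_ubound M)).
by exists 0 => /=; rewrite ?mulmx0 enorm0.
Qed.

Lemma enorm_mulmx_le (R : realType) (m n : nat) (M : 'M[R]_(m, n))
    (x : 'cV[R]_n) : enorm (M *m x) <= specnorm M * enorm x.
Proof.
have [x0|x0] := eqVneq (enorm x) 0.
  by rewrite (enorm_eq0 x0) mulmx0 !enorm0 mulr0.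
have x_gt0 : 0 < enorm x by rewrite lt_neqAle enorm_ge0 eq_sym x0.
rewrite -ler_pdivrMr//; apply: (ub_le_sup (specnorm_has_ubound M)).
exists ((enorm x)^-1 *: x) => /=.
  by rewrite enormZ ger0_norm ?invr_ge0 ?enorm_ge0// mulVf.
by rewrite -scalemxAr enormZ ger0_norm ?invr_ge0 ?enorm_ge0// mulrC.
Qed.

(* [|M^T x|^2 = <x, M M^T x> <= ||M|| |x| |M^T x|] *)
Lemma enorm_mulmx_tr_le (R : realType) (m n : nat) (M : 'M[R]_(m, n))
    (x : 'cV[R]_m) : enorm (M^T *m x) <= specnorm M * enorm x.
Proof.
have [x0|x0] := eqVneq (enorm (M^T *m x)) 0.
  by rewrite x0 mulr_ge0 ?enorm_ge0 ?specnorm_ge0.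
have x_gt0 : 0 < enorm (M^T *m x) by rewrite lt_neqAle enorm_ge0 eq_sym x0.
rewrite -(ler_pM2r x_gt0) -expr2 enorm_sqr edot_mulmxl trmxK.
apply: (le_trans (edot_le_enorm _ _)).
rewrite mulrAC mulrC ler_wpM2r ?enorm_ge0//; exact: enorm_mulmx_le.
Qed.

(** * Moore-Penrose inverse *)

(** Transposing MX = (MY)(MX) gives MX = (MX)(MY) = MY by symmetry, and likewise XM = YM; then X =
    XMX = YMY = Y. *)
Lemma penrose_uniq (R : realType) (m n : nat) (M : 'M[R]_(m, n))
    (X Y : 'M[R]_(n, m)) : penrose M X -> penrose M Y -> X = Y.
Proof.
move=> [MXM XMX MXs XMs] [MYM YMY MYs YMs].
have MXY : M *m X = M *m Y.
  have : (M *m X)^T = ((M *m Y) *m (M *m X))^T by rewrite mulmxA MYM.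
  by rewrite [RHS]trmx_mul MXs MYs mulmxA MXM.
have XYM : X *m M = Y *m M.
  have : (X *m M)^T = ((X *m M) *m (Y *m M))^T.
    by rewrite -mulmxA (mulmxA M Y M) MYM.
  by rewrite [RHS]trmx_mul XMs YMs -mulmxA (mulmxA M X M) MXM.
by rewrite -XMX -mulmxA MXY mulmxA XYM YMY.
Qed.

(** If v W W^T = 0 then |v W|^2 = v W W^T v^T = 0, so v W = 0 and v = 0. *)
Lemma row_free_gram_unit (R : realType) (m n : nat) (W : 'M[R]_(m, n)) :
  row_free W -> W *m W^T \in unitmx.
Proof.
move=> W_free; rewrite -row_free_unit; apply: inj_row_free => v vWW.
apply: (row_free_inj W_free); rewrite mul0mx; apply: trmx_inj.
rewrite trmx0; apply: enorm_eq0; apply/eqP.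
rewrite -sqrf_eq0 enorm_sqr trmx_mul edot_mulmxl trmxK.
have -> : W *m (W^T *m v^T) = (v *m (W *m W^T))^T.
  by rewrite !trmx_mul trmxK mulmxA.
by rewrite vWW /edot big1// => i _; rewrite trmx0 [X in _ * X]mxE mulr0.
Qed.

Lemma penrose_row_free (R : realType) (m n : nat) (W : 'M[R]_(m, n)) :
  row_free W -> penrose W (W^T *m invmx (W *m W^T)).
Proof.
move=> /row_free_gram_unit Wu.
have W1 : W *m (W^T *m invmx (W *m W^T)) = 1%:M by rewrite mulmxA mulmxV.
split.
- by rewrite W1 mul1mx.
- by rewrite -mulmxA W1 mulmx1.
- by rewrite W1 trmx1.
- by rewrite !trmx_mul trmx_inv trmx_mul !trmxK mulmxA.
Qed.

Lemma penrose_tr (R : realType) (m n : nat) (M : 'M[R]_(m, n))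
    (X : 'M[R]_(n, m)) : penrose M X -> penrose M^T X^T.
Proof.
move=> [MXM XMX MXs XMs]; split.
- by rewrite -mulmxA -!trmx_mul MXM.
- by rewrite -mulmxA -!trmx_mul XMX.
- by rewrite -trmx_mul XMs.
- by rewrite -trmx_mul MXs.
Qed.

Lemma mpinv_eq (R : realType) (m n : nat) (M : 'M[R]_(m, n))
    (X : 'M[R]_(n, m)) : penrose M X -> mpinv M = X.
Proof.
move=> MX; apply: (@penrose_uniq _ _ _ M) => //.
by apply: (@xgetPex _ _ [set X | penrose M X]); exists X.
Qed.

(** Lets norms of products with [mpinv W^T] be bounded by [specnorm (mpinv W)], the quantity in the
    hypothesis on the step parameters. *)
Lemma mpinv_tr_row_free (R : realType) (m n : nat) (W : 'M[R]_(m, n)) :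
  row_free W -> mpinv W^T = (mpinv W)^T.
Proof.
move=> /penrose_row_free WX.
by rewrite (mpinv_eq WX) (mpinv_eq (penrose_tr WX)).
Qed.

Lemma mulmx_mpinv_row_free (R : realType) (m n : nat) (W : 'M[R]_(m, n)) :
  row_free W -> W *m mpinv W = 1%:M.
Proof.
move=> Wf; rewrite (mpinv_eq (penrose_row_free Wf)).
by rewrite mulmxA mulmxV// row_free_gram_unit.
Qed.

(** * Triangle inequality and counting norm *)

Lemma enormD_le (R : realType) (n : nat) (x y : 'cV[R]_n) :
  enorm (x + y) <= enorm x + enorm y.
Proof.
rewrite -ler_sqr ?nnegrE ?addr_ge0 ?enorm_ge0// enormD_sqr sqrrD lerD2r lerD2l.
by rewrite mulr_natl ler_wMn2r// edot_le_enorm.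
Qed.

Lemma enormN (R : realType) (n : nat) (x : 'cV[R]_n) : enorm (- x) = enorm x.
Proof. by rewrite -scaleN1r enormZ normrN1 mul1r. Qed.

Lemma l0norm_sum (R : realType) (m : nat) (y : 'cV[R]_m) :
  (l0norm y)%:R = \sum_(i < m) (y i 0 != 0)%:R :> R.
Proof.
rewrite /l0norm -sum1_card big_mkcond natr_sum; apply: eq_bigr => i _.
by rewrite inE; case: ifP.
Qed.

(** * First-order conditions of the two minimization steps *)

(** For a small h of sign opposite to a, the linear term would dominate and be negative. Restricting
    h to a window serves the y-step, where only small moves preserve the support. *)
Lemma linear_part_eq0 (R : realType) (a b e : R) : 0 < e ->
  (forall h, `|h| < e -> 0 <= h * a + h ^+ 2 * b) -> a = 0.
Proof.
move=> e_gt0 ab_ge0; apply/eqP; rewrite -normr_le0 leNgt; apply/negP => a_gt0.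
(* The test point is h = - r a, where the value is r a^2 (r b - 1); this r ensures both r |a| < e
   and r b < 1. *)
pose r := (`|b| + 1 + `|a| / e + 1)^-1.
have ae_gt0 : 0 < `|a| / e by rewrite divr_gt0.
have b_ge0 := normr_ge0 b.
have r_gt0 : 0 < r by rewrite invr_gt0; lra.
have rE : r * `|b| + r + r * (`|a| / e) + r = 1.
  by rewrite -[RHS](@mulVf _ (`|b| + 1 + `|a| / e + 1)) -/r; [ring | lra].
have ra : r * `|a| < e.
  have : r * (`|a| / e) < 1 by nra.
  by rewrite mulrA ltr_pdivrMr // mul1r.
have := ab_ge0 (- (r * a)).
rewrite normrN normrM (gtr0_norm r_gt0) => /(_ ra).
have rb : r * b < 1.
  apply: le_lt_trans (_ : r * `|b| < 1).
    by rewrite ler_wpM2l ?ler_norm ?ltW.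
  nra.
have a2 : 0 < a ^+ 2 by rewrite exprn_even_gt0//= -normr_gt0.
have -> : - (r * a) * a + (- (r * a)) ^+ 2 * b
    = r * a ^+ 2 * (r * b - 1) by ring.
rewrite pmulr_rge0; last exact: mulr_gt0.
by rewrite leNgt subr_lt0 rb.
Qed.

Lemma lsq_line (R : realType) (p n : nat) (A : 'M[R]_(p, n)) (b : 'cV[R]_p)
    (u d : 'cV[R]_n) (h : R) :
  lsq A b (u + h *: d) = lsq A b u + h * edot (A^T *m (A *m u - b)) d
                         + h ^+ 2 * (2^-1 * enorm (A *m d) ^+ 2).
Proof.
have -> : edot (A^T *m (A *m u - b)) d = edot (A *m u - b) (A *m d).
  by rewrite edot_mulmxl trmxK.
rewrite /lsq mulmxDr -scalemxAr addrAC enormD_sqr enormZ edotZr exprMn.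
by rewrite real_normK ?num_real//; field.
Qed.

(** By [lsq_line] the difference quotient is exactly affine in h, so its limit is its constant
    term. *)
Lemma gradient_lsq (R : realType) (p n : nat) (A : 'M[R]_(p, n))
    (b : 'cV[R]_p) (u : 'cV[R]_n) :
  gradient (lsq A b) u = A^T *m (A *m u - b).
Proof.
apply/colP => i; rewrite mxE /derive -[RHS]edot_delta.
set d := delta_mx i 0; set a := edot _ _.
apply/cvg_lim => //.
set c := 2^-1 * enorm (A *m d) ^+ 2.
have lin : (a + h * c) @[h --> 0^'] --> a + 0 * c.
  by apply: cvgD; [exact: cvg_cst | apply: cvgMl; exact: cvg_within].
rewrite mul0r addr0 in lin.
apply: cvg_trans lin; apply: near_eq_cvg; near=> h.
have h0 : h != 0 by near: h; exact: nbhs_dnbhs_neq.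
rewrite /= (addrC (h *: d)) lsq_line -/a -/c /GRing.scale /=; field.
Unshelve. all: by end_near. Qed.

Lemma zmapE (R : realType) (p m n : nat) (A : 'M[R]_(p, n)) (b : 'cV[R]_p)
    (W : 'M[R]_(m, n)) (beta : R) (u : 'cV[R]_n) :
  zmap A b W beta u =
  - (mpinv W^T *m ((A^T *m A + beta *: (W^T *m W)) *m u - A^T *m b)).
Proof.
rewrite /zmap gradient_lsq -opprD mulmxN mulmxBr mulmxDl scalemxAl mulmxA.
by rewrite addrAC.
Qed.

(** Along each coordinate direction the objective is a quadratic polynomial in the step h, so
    [linear_part_eq0] kills every coordinate of the gradient. *)
Lemma u_step_stationary (R : realType) (p m n : nat) (A : 'M[R]_(p, n))
    (b : 'cV[R]_p) (W : 'M[R]_(m, n)) (beta rho tk : R)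
    (uk v : 'cV[R]_n) (yk zk : 'cV[R]_m) :
  argmin (u_objective A b W beta rho tk uk yk zk) v ->
  (A^T *m A + beta *: (W^T *m W)) *m v - A^T *m b + W^T *m zk
  + tk *: (v - uk) + rho *: (W^T *m (W *m v - yk)) = 0.
Proof.
move=> v_min; set g := LHS.
have gE : g = A^T *m (A *m v - b) + W^T *m zk + beta *: (W^T *m (W *m v))
              + tk *: (v - uk) + rho *: (W^T *m (W *m v - yk)).
  rewrite /g mulmxDl -scalemxAl !mulmxA !mulmxBr !mulmxA; congr (_ + _ + _).
  by rewrite [RHS]addrAC; congr (_ + _); rewrite addrAC.
clearbody g; apply/colP => i; rewrite -edot_delta mxE; set d := delta_mx i 0.
(* The coefficient of h^2 in the objective along [d]. *)
pose q := 2^-1 * enorm (A *m d) ^+ 2 + beta / 2 * enorm (W *m d) ^+ 2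
          + tk / 2 * enorm d ^+ 2 + rho / 2 * enorm (W *m d) ^+ 2.
apply: (@linear_part_eq0 _ _ q 1) => // h _.
have := v_min (v + h *: d); rewrite -subr_ge0; congr (0 <= _).
rewrite /u_objective lsq_line (mulmxDr W) -(scalemxAr h W).
rewrite (addrAC v (h *: d)) (addrAC (W *m v) (h *: (W *m d))).
rewrite !enormD_sqr !enormZ !edotDl !edotZl !edotZr.
rewrite !exprMn real_normK ?num_real//.
rewrite gE /q !edotDl !edotZl !(edot_mulmxl W^T) !trmxK.
by rewrite !edotDl (edotC zk); field.
Qed.

(** Moving a nonzero coordinate by less than its absolute value leaves [l0norm] unchanged, so only
    the quadratic part of the objective varies. *)
Lemma y_step_stationary (R : realType) (m n : nat) (W : 'M[R]_(m, n))
    (lam rho tk : R) (u1 : 'cV[R]_n) (yk z1 y1 : 'cV[R]_m) (i : 'I_m) :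
  argmin (y_objective W lam rho tk u1 yk z1) y1 ->
  y1 i 0 != 0 ->
  z1 i 0 = tk * (y1 - yk) i 0 - rho * (W *m u1 - y1) i 0.
Proof.
move=> y_min yi0; apply/eqP; rewrite -subr_eq0; apply/eqP.
pose d : 'cV[R]_m := delta_mx i 0.
pose g := - z1 + tk *: (y1 - yk) - rho *: (W *m u1 - y1).
suff : edot g d = 0.
  by rewrite edot_delta /g !mxE => gi0; lra.
apply: (@linear_part_eq0 _ _ ((tk / 2 + rho / 2) * enorm d ^+ 2) `|y1 i 0|).
  by rewrite normr_gt0.
move=> h hy.
have l0E : l0norm (y1 + h *: d) = l0norm y1.
  apply: eq_card => j; rewrite !inE !mxE eqxx andbT.
  have [->|] := eqVneq j i; last by rewrite mulr0 addr0.
  rewrite mulr1 yi0; apply: contraTneq hy => /eqP; rewrite addr_eq0 => /eqP ->.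
  by rewrite normrN ltxx.
have := y_min (y1 + h *: d); rewrite -subr_ge0; congr (0 <= _).
rewrite /y_objective l0E opprD.
rewrite (addrAC y1 (h *: d)) (addrA (W *m u1)) -scaleNr !enormD_sqr !enormZ.
rewrite !edotDl !edotZl !edotZr !exprMn !real_normK ?num_real// sqrrN.
by rewrite /g !edotDl !edotNl !edotZl !edotDl !edotNl (edotC z1); field.
Qed.

(** * Descent of the augmented Lagrangian *)

Definition augmented_lagrangian (R : realType) (p m n : nat)
    (A : 'M[R]_(p, n)) (b : 'cV[R]_p) (W : 'M[R]_(m, n)) (lam beta rho : R)
    (u : 'cV[R]_n) (y z : 'cV[R]_m) : R :=
  lsq A b u + lam * (l0norm y)%:R + beta / 2 * enorm (W *m u) ^+ 2
  + edot (W *m u - y) z + rho / 2 * enorm (W *m u - y) ^+ 2.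

(** Compare u' with u and y' with y in their objectives, where the proximal terms vanish, and add.
    The inner product is the change caused by replacing z with z' at (u', y). *)
Lemma augmented_lagrangian_step (R : realType) (p m n : nat)
    (A : 'M[R]_(p, n)) (b : 'cV[R]_p) (W : 'M[R]_(m, n))
    (lam beta rho tk : R) (u u' : 'cV[R]_n) (y z y' z' : 'cV[R]_m) :
  argmin (u_objective A b W beta rho tk u y z) u' ->
  argmin (y_objective W lam rho tk u' y z') y' ->
  augmented_lagrangian A b W lam beta rho u' y' z'
  + tk / 2 * enorm (u' - u) ^+ 2 + tk / 2 * enorm (y' - y) ^+ 2
  <= augmented_lagrangian A b W lam beta rho u y z
     + edot (W *m u' - y) (z' - z).
Proof.
move=> /(_ u) + /(_ y).
rewrite /u_objective /y_objective /augmented_lagrangian !subrr !enorm0.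
rewrite edotDr edotNr expr0n/= !mulr0; lra.
Qed.

(** Complete the square in W u - y + z / rho; the other terms are nonnegative. *)
Lemma augmented_lagrangian_ge (R : realType) (p m n : nat)
    (A : 'M[R]_(p, n)) (b : 'cV[R]_p) (W : 'M[R]_(m, n)) (lam beta rho : R)
    (u : 'cV[R]_n) (y z : 'cV[R]_m) : 0 <= lam -> 0 <= beta -> 0 < rho ->
  - ((2 * rho)^-1 * enorm z ^+ 2)
  <= augmented_lagrangian A b W lam beta rho u y z.
Proof.
move=> lam_ge0 beta_ge0 rho_gt0.
have : 0 <= rho / 2 * enorm (W *m u - y + rho^-1 *: z) ^+ 2.
  by rewrite mulr_ge0 ?sqr_ge0// divr_ge0 ?ltW.
rewrite enormD_sqr enormZ edotZr exprMn real_normK ?num_real//.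
have -> : rho / 2 * (enorm (W *m u - y) ^+ 2
      + 2 * (rho^-1 * edot (W *m u - y) z) + rho^-1 ^+ 2 * enorm z ^+ 2)
    = rho / 2 * enorm (W *m u - y) ^+ 2 + edot (W *m u - y) z
      + (2 * rho)^-1 * enorm z ^+ 2.
  by field; rewrite gt_eqF.
have : 0 <= lsq A b u by rewrite /lsq mulr_ge0 ?sqr_ge0// invr_ge0.
have : 0 <= lam * (l0norm y)%:R :> R by rewrite mulr_ge0.
have : 0 <= beta / 2 * enorm (W *m u) ^+ 2.
  by rewrite mulr_ge0 ?sqr_ge0// divr_ge0.
rewrite /augmented_lagrangian; lra.
Qed.

Lemma mpinv_tr_mulmx (R : realType) (m n : nat) (W : 'M[R]_(m, n)) :
  row_free W -> mpinv W^T *m W^T = 1%:M.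
Proof.
move=> Wf; rewrite mpinv_tr_row_free// -trmx_mul mulmx_mpinv_row_free//.
exact: trmx1.
Qed.

(** Multiplying the stationarity condition by [mpinv W^T] cancels W^T. Since the multiplier is
    itself minus [mpinv W^T] times the gradient at u, only the increment u' - u survives. *)
Lemma u_step_residual (R : realType) (p m n : nat) (A : 'M[R]_(p, n))
    (b : 'cV[R]_p) (W : 'M[R]_(m, n)) (beta rho tk : R)
    (u u' : 'cV[R]_n) (y : 'cV[R]_m) :
  row_free W ->
  argmin (u_objective A b W beta rho tk u y (zmap A b W beta u)) u' ->
  rho *: (W *m u' - y) =
  - (mpinv W^T *m ((A^T *m A + beta *: (W^T *m W)) *m (u' - u)
                   + tk *: (u' - u))).
Proof.
move=> Wf /u_step_stationary /(congr1 (mulmx (mpinv W^T))).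
rewrite zmapE mulmx0; set M := mpinv W^T.
rewrite !(mulmxDr M) -(scalemxAr rho) !(mulmxA M W^T) mpinv_tr_mulmx// !mul1mx.
move/(canRL (addKr _)); rewrite addr0 => ->; congr (- _).
by rewrite (mulmxBr _ u') (mulmxBr M) opprD addrACA subrr addr0.
Qed.

(** After multiplication by rho both factors are images of u' - u, and Cauchy-Schwarz applies. The
    assumptions tk <= rho and 1 <= rho give |H| + tk <= rho (|H| + 1), so the factor rho cancels. *)
Lemma edot_residual_le (R : realType) (p m n : nat) (A : 'M[R]_(p, n))
    (b : 'cV[R]_p) (W : 'M[R]_(m, n)) (beta rho tk : R)
    (u u' : 'cV[R]_n) (y : 'cV[R]_m) :
  let H := A^T *m A + beta *: (W^T *m W) in
  row_free W -> 0 < tk -> tk <= rho -> 1 <= rho ->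
  argmin (u_objective A b W beta rho tk u y (zmap A b W beta u)) u' ->
  edot (W *m u' - y) (zmap A b W beta u' - zmap A b W beta u)
  <= (specnorm H + 1) * specnorm (mpinv W) ^+ 2 * specnorm H
     * enorm (u' - u) ^+ 2.
Proof.
move=> H Wf tk_gt0 tk_le rho_ge1 /(u_step_residual Wf); rewrite -/H.
rewrite !zmapE -/H -opprD -mulmxBr opprB addrA subrK -mulmxBr.
rewrite mpinv_tr_row_free//.
set d := u' - u; set M := mpinv W; set w := W *m u' - y => wE.
have rho_gt0 : 0 < rho by lra.
rewrite -(ler_pM2l rho_gt0) -edotZl wE edotNl edotNr opprK.
apply: (le_trans (edot_le_enorm _ _)).
have h0 := specnorm_ge0 H; have m0 := specnorm_ge0 M; have d0 := enorm_ge0 d.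
have Hd := enorm_mulmx_le H d.
have MH : enorm (M^T *m (H *m d)) <= specnorm M * (specnorm H * enorm d).
  by apply: (le_trans (enorm_mulmx_tr_le _ _)); rewrite ler_wpM2l.
have MHt : enorm (M^T *m (H *m d + tk *: d))
    <= specnorm M * (rho * (specnorm H + 1) * enorm d).
  apply: (le_trans (enorm_mulmx_tr_le _ _)); rewrite ler_wpM2l//.
  apply: (le_trans (enormD_le _ _)); rewrite enormZ gtr0_norm//.
  have : specnorm H * enorm d <= rho * (specnorm H * enorm d).
    by rewrite ler_peMl// mulr_ge0.
  have : tk * enorm d <= rho * enorm d by rewrite ler_wpM2r.
  lra.
apply: (le_trans (ler_pM (enorm_ge0 _) (enorm_ge0 _) MHt MH)).
by rewrite le_eqVlt; apply/orP; left; apply/eqP; ring.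
Qed.

(** * Vanishing sequences, limit points and subgradients *)

Lemma cvg0_le (R : realType) (C : R) (f d : R^nat) :
  (forall k, `|f k| <= C * d k) -> d @ \oo --> 0 -> f @ \oo --> 0.
Proof.
move=> fd d0; apply: norm_cvg0.
apply: (@squeeze_cvgr _ _ _ _ (fun=> 0) (fun k => C * d k)).
- by apply: nearW => k; rewrite normr_ge0 fd.
- exact: cvg_cst.
- by rewrite -[X in _ --> X](mulr0 C); apply: cvgMr.
Qed.

Lemma cvg0_sqr (R : realType) (f : R^nat) :
  (fun k => f k ^+ 2) @ \oo --> 0 -> f @ \oo --> 0.
Proof.
move=> /cvgr0Pnorm_lt f0; apply/cvgr0Pnorm_lt => e e0.
have e2 : 0 < e ^+ 2 by rewrite exprn_gt0.
apply: filterS (f0 _ e2) => k; rewrite normrX ltr_sqr ?nnegrE ?normr_ge0 ?ltW//.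
Qed.

(** L is nonincreasing and bounded below, hence convergent; its consecutive differences tend to 0
    and dominate c e. *)
Lemma descent_cvg0 (R : realType) (B c : R) (L e : R^nat) :
  0 < c -> (forall k, 0 <= e k) -> (forall k, L k.+1 + c * e k <= L k) ->
  (forall k, B <= L k) -> e @ \oo --> 0.
Proof.
move=> c0 e0 Le BL.
have L_cvg : cvgn L.
  apply: nonincreasing_is_cvgn.
    apply/nonincreasing_seqP => k; have := Le k.
    by have := mulr_ge0 (ltW c0) (e0 k); lra.
  by exists B => _ [k _ <-].
have dL0 : (L k - L k.+1) @[k --> \oo] --> 0.
  rewrite -(subrr (limn L)); apply: cvgB => //.
  by have := L_cvg; rewrite -{1}(cvg_shiftS L).
apply: (@cvg0_le _ c^-1 _ _ _ dL0) => k.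
rewrite ger0_norm// ler_pdivlMl//; have := Le k; lra.
Qed.

(** No subsequence is extracted: a tail on which F is near l meets every neighbourhood of xs, so F
    xs and l cannot be separated. *)
Lemma cluster_cvg_eq (R : realType) (T : topologicalType) (x : nat -> T)
    (xs : T) (F : T -> R) (l : R) :
  cluster (x k @[k --> \oo]) xs -> {for xs, continuous F} ->
  F (x k) @[k --> \oo] --> l -> F xs = l.
Proof.
move=> x_xs F_cont Fl; apply: Rhausdorff => U V FU lV.
have [z [zV zU]] := x_xs (F @^-1` V) (F @^-1` U) (Fl _ lV) (F_cont _ FU).
by exists (F z).
Qed.

Lemma mulmx_coord_continuous (R : realType) (m n : nat) (M : 'M[R]_(m, n))
    (i : 'I_m) : continuous (fun v : 'cV[R]_n => (M *m v) i 0).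
Proof.
have -> : (fun v : 'cV[R]_n => (M *m v) i 0) = fun v => \sum_j M i j * v j 0.
  by apply/funext => v; rewrite mxE.
elim: (index_enum _) => [|j r IHr].
  have -> : (fun v : 'cV[R]_n => \sum_(j <- [::]) M i j * v j 0) = cst 0.
    by apply/funext => v; rewrite big_nil.
  exact: cst_continuous.
have -> : (fun v : 'cV[R]_n => \sum_(k <- j :: r) M i k * v k 0) =
    (fun v => M i j * v j 0 + \sum_(k <- r) M i k * v k 0).
  by apply/funext => v; rewrite big_cons.
move=> v; apply: (@cvgD _ _ _ (nbhs v)); last exact: IHr.
by apply: (@cvgM _ _ (nbhs v)); [exact: cvg_cst | exact: coord_continuous].
Qed.

(** The norm on the right is the library max norm, in which boundedness of the iterates is
    stated. *)
Lemma cV_coord_le_norm (R : realType) (n : nat) (x : 'cV[R]_n) (i : 'I_n) :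
  `|x i 0| <= `|x|.
Proof.
rewrite [leRHS]/Num.norm /= mx_normrE.
exact: (@le_bigmax _ _ _ _ (fun ij => `|x ij.1 ij.2|) (i, 0)).
Qed.

(* [z] is even a Frechet subgradient at [y], so constant sequences serve as the
   witnesses. *)
Lemma l0norm_limiting_subgradient (R : realType) (m : nat) (lam : R)
    (y z : 'cV[R]_m) : 0 < lam -> (forall i, y i 0 * z i 0 = 0) ->
  limiting_subdifferential (fun x : 'cV[R]_m => lam * (l0norm x)%:R) y z.
Proof.
move=> lam0 yz; exists (fun=> y), (fun=> z); split; try exact: cvg_cst.
move=> _ e e0.
(* Both the counting norm and the inner product split over coordinates. If y_i = 0, the jump lam
   outweighs x_i z_i near y; otherwise z_i = 0 and x_i stays nonzero. *)
have near_i i : \forall x \near y, 0 <= lam * ((x : 'cV[R]_m) i 0 != 0)%:R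
    - lam * (y i 0 != 0)%:R - (x i 0 - y i 0) * z i 0.
  have [yi0|yi0] := eqVneq (y i 0) 0.
    have xz : ((x : 'cV[R]_m) i 0 * z i 0) @[x --> y] --> y i 0 * z i 0.
      apply: (@cvgM _ _ (nbhs y)); first exact: coord_continuous.
      exact: cvg_cst.
    rewrite yz in xz.
    have /cvgr0Pnorm_lt /(_ _ lam0) := xz; apply: filterS => x xlt.
    rewrite yi0 mulr0 !subr0.
    have [->|_] := eqVneq (x i 0) 0; first by rewrite mulr0 mul0r subr0.
    by rewrite mulr1 subr_ge0 ltW// (le_lt_trans (ler_norm _)).
  have zi0 : z i 0 = 0.
    by apply/eqP; have /eqP := yz i; rewrite mulf_eq0 (negbTE yi0).
  have /cvgr_neq0 : (x : 'cV[R]_m) i 0 @[x --> y] --> y i 0.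
    exact: coord_continuous.
  move=> /(_ yi0); apply: filterS => x xi0.
  by rewrite zi0 mulr0 subr0 xi0 subrr.
apply: filterS (filter_forall (nbhs_filter y) near_i) => x x_ge0.
apply: (@le_trans _ _ 0); first by rewrite oppr_le0 mulr_ge0 ?enorm_ge0// ltW.
rewrite !l0norm_sum edotC /edot !mulr_sumr -!sumrB; apply: sumr_ge0 => i _.
by have := x_ge0 i; rewrite !mxE.
Qed.

(** N annihilates W^T, hence the multiplier and penalty terms; only the proximal term remains. *)
Lemma u_step_projected_gradient (R : realType) (p m n : nat)
    (A : 'M[R]_(p, n)) (b : 'cV[R]_p) (W : 'M[R]_(m, n)) (beta rho tk : R)
    (u u' : 'cV[R]_n) (y z : 'cV[R]_m) :
  let N := 1%:M - W^T *m mpinv W^T in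
  row_free W -> argmin (u_objective A b W beta rho tk u y z) u' ->
  N *m ((A^T *m A + beta *: (W^T *m W)) *m u' - A^T *m b)
  = - (tk *: (N *m (u' - u))).
Proof.
move=> N Wf /u_step_stationary; set g := _ *m u' - _.
have NW : N *m W^T = 0.
  by rewrite mulmxBl mul1mx -mulmxA mpinv_tr_mulmx// mulmx1 subrr.
clearbody N g; move: (W *m u' - y) (u' - u) => w d.
move=> /(congr1 (mulmx N)); rewrite !mulmxDr -!scalemxAr !mulmxA NW.
rewrite !mul0mx mulmx0.
by rewrite scaler0 !addr0 => /eqP; rewrite addr_eq0 => /eqP.
Qed.

Theorem theorem3p12 (R : realType) (p m n : nat)
    (A : 'M[R]_(p, n)) (u0 : 'cV[R]_p) (W : 'M[R]_(m, n))
    (lam beta rho c t : R) (t_ : nat -> R)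
    (u : nat -> 'cV[R]_n) (y : nat -> 'cV[R]_m)
    (lam_gt0 : 0 < lam) (beta_gt0 : 0 < beta) (rho_gt0 : 0 < rho)
    (t_gt0 : forall k, 0 < t_ k)
    (W_full_row_rank : row_free W)
    (uy_generated : generated_by_algorithm A u0 W lam beta rho t_ u y)
    (uy_bounded : bounded_set (range (fun k => (u k, y k))))
    (t_max : range t_ t /\ forall k, t_ k <= t)
    (rho_ge : Num.max t 1 <= rho)
    (c_gt0 : 0 < c)
    (t_ge : let H := A^T *m A + beta *: (W^T *m W) in
      forall k,
        Num.max
          (4 * (specnorm (W^T *m mpinv W^T *m H)
                + specnorm (W^T *m W) * specnorm (mpinv W) ^+ 2 * specnorm H
                + (specnorm H + 1) * specnorm (mpinv W) ^+ 2 * specnorm H))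
          c
        <= t_ k)
    (ustar : 'cV[R]_n) (ystar : 'cV[R]_m)
    (limit_point_uy : cluster ((u k, y k) @[k --> \oo]) (ustar, ystar)) :
  KKT_point A u0 W lam beta ustar ystar.
Proof.
case: uy_generated => _ [z [z0 step]].
have zE k : z k = zmap A u0 W beta (u k).
  by case: k => [//|k]; have [_ ->] := step k.
have ustep k : argmin (u_objective A u0 W beta rho (t_ k) (u k) (y k)
    (zmap A u0 W beta (u k))) (u k.+1) by rewrite -zE; have [] := step k.
have ystep k : argmin (y_objective W lam rho (t_ k) (u k.+1) (y k)
    (zmap A u0 W beta (u k.+1))) (y k.+1) by rewrite -zE; have [] := step k.
move: t_ge => /=; set H := A^T *m A + _ => t_ge.
set M := mpinv W^T; set q := A^T *m u0.
have MW : M *m W^T = 1%:M by exact: mpinv_tr_mulmx.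
have zmE v : zmap A u0 W beta v = - (M *m (H *m v - q)) by exact: zmapE.
have [t_le_rho rho_ge1] : t <= rho /\ 1 <= rho.
  by move: rho_ge; rewrite ge_max => /andP.
have t_le k : t_ k <= t by case: t_max.
have h0 := specnorm_ge0 H.
pose d k := enorm (u k.+1 - u k); pose e k := enorm (y k.+1 - y k).
have d0 k : 0 <= d k by exact: enorm_ge0.
have e0 k : 0 <= e k by exact: enorm_ge0.
(* [bounded_set] yields bounds only strictly above some real [K0], whence the added 1. *)
have [K K0 [uK yK]] : exists2 K : R, 0 <= K &
    (forall k i, `|u k i 0| <= K) /\ (forall k i, `|y k i 0| <= K).
  have [K0 [_ /(_ (`|K0| + 1))]] := uy_bounded.
  have K0lt : K0 < `|K0| + 1 by rewrite (le_lt_trans (ler_norm _))// ltrDl.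
  move=> /(_ K0lt) bnd; exists (`|K0| + 1); first by rewrite addr_ge0.
  have uyK k : `|(u k, y k)| <= `|K0| + 1 by apply: bnd; exists k.
  split=> k i; have := uyK k; rewrite prod_normE /= ge_max => /andP[uk yk].
    exact: le_trans (cV_coord_le_norm _ _) uk.
  exact: le_trans (cV_coord_le_norm _ _) yk.
pose L k := augmented_lagrangian A u0 W lam beta rho (u k) (y k)
  (zmap A u0 W beta (u k)).
(* Of the gain t_k / 2 in d^2, at most t_k / 4 is lost to the multiplier update, because t_k is at
   least four times the third summand of its lower bound. What remains is at least c / 4, as is the
   gain in e^2. *)
have L_decr k : L k.+1 + c / 4 * (d k ^+ 2 + e k ^+ 2) <= L k.
  have := augmented_lagrangian_step (ustep k) (ystep k).
  have := edot_residual_le W_full_row_rank (t_gt0 k)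
    (le_trans (t_le k) t_le_rho) rho_ge1 (ustep k).
  rewrite -/H -/(L k.+1) -/(L k) -/(d k) -/(e k).
  have := t_ge k; rewrite ge_max => /andP[].
  have := specnorm_ge0 (W^T *m mpinv W^T *m H).
  have : 0 <= specnorm (W^T *m W) * specnorm (mpinv W) ^+ 2 * specnorm H.
    by rewrite !mulr_ge0 ?exprn_ge0 ?specnorm_ge0.
  set X := (specnorm H + 1) * _ * _; set S1 := specnorm _.
  set S2 := _ * specnorm H.
  move=> S20 S10 Xt ct.
  have d2 := sqr_ge0 (d k); have e2 := sqr_ge0 (e k).
  have : X * d k ^+ 2 <= t_ k / 4 * d k ^+ 2 by rewrite ler_wpM2r//; lra.
  have : c / 4 * d k ^+ 2 <= t_ k / 4 * d k ^+ 2 by rewrite ler_wpM2r//; lra.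
  have : c / 4 * e k ^+ 2 <= t_ k / 2 * e k ^+ 2.
    by rewrite ler_wpM2r//; have := t_gt0 k; lra.
  lra.
have [B LB] : exists B, forall k, B <= L k.
  (* Z bounds the multipliers: n K bounds the sum of the absolute entries of u_k, hence its
     Euclidean norm. *)
  pose Z := specnorm M * (specnorm H * (n%:R * K) + enorm q).
  exists (- ((2 * rho)^-1 * Z ^+ 2)) => k.
  apply: le_trans (augmented_lagrangian_ge _ _ _ _ _ _
    (ltW lam_gt0) (ltW beta_gt0) rho_gt0).
  rewrite lerN2 ler_wpM2l ?invr_ge0 ?mulr_ge0 ?(ltW rho_gt0)//.
  have Z0 : 0 <= Z.
    by rewrite mulr_ge0 ?addr_ge0 ?enorm_ge0 ?specnorm_ge0// !mulr_ge0.
  rewrite ler_sqr ?nnegrE ?enorm_ge0//.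
  rewrite zmE enormN; apply: (le_trans (enorm_mulmx_le _ _)).
  rewrite ler_wpM2l ?specnorm_ge0//; apply: (le_trans (enormD_le _ _)).
  rewrite enormN lerD2r; apply: (le_trans (enorm_mulmx_le _ _)).
  rewrite ler_wpM2l//; apply: (le_trans (enorm_sum _)).
  rewrite -[X in X%:R * K](card_ord n) -sum1_card natr_sum mulr_suml.
  by apply: ler_sum => i _; rewrite mul1r.
have de_cvg0 : (fun k => d k + e k) @ \oo --> 0.
  (* The constant 2 comes from (d + e)^2 <= 2 (d^2 + e^2). *)
  apply: cvg0_sqr; apply: (@cvg0_le _ 2).
    2: apply: (descent_cvg0 _ _ L_decr LB); [by rewrite divr_gt0|].
    2: by move=> k; rewrite addr_ge0 ?sqr_ge0.
  move=> k /=; rewrite ger0_norm ?sqr_ge0//.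
  have := sqr_ge0 (d k - e k); rewrite sqrrB sqrrD; lra.
pose G := rho^-1 * (specnorm M * (specnorm H + t)).
have gap k : enorm (W *m u k.+1 - y k) <= G * d k.
  have := u_step_residual W_full_row_rank (ustep k); rewrite -/H -/M.
  move=> /(congr1 (@enorm _ _)); rewrite enormN enormZ gtr0_norm// => gapE.
  rewrite /G -mulrA -(ler_pM2l rho_gt0) gapE mulVKf ?gt_eqF//.
  apply: (le_trans (enorm_mulmx_le _ _)); rewrite -mulrA.
  rewrite ler_wpM2l ?specnorm_ge0//; apply: (le_trans (enormD_le _ _)).
  rewrite mulrDl lerD// ?enorm_mulmx_le// enormZ gtr0_norm//.
  by rewrite -/(d k) ler_wpM2r.
have t0 : 0 < t by apply: lt_le_trans (t_gt0 0%N) (t_le 0%N).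
have G0 : 0 <= G.
  by rewrite !mulr_ge0 ?invr_ge0 ?addr_ge0 ?specnorm_ge0// ltW.
have infeas k : enorm (W *m u k.+1 - y k.+1) <= (G + 1) * (d k + e k).
  have -> : W *m u k.+1 - y k.+1 = (W *m u k.+1 - y k) - (y k.+1 - y k).
    by rewrite opprB addrA subrK.
  apply: (le_trans (enormD_le _ _)); rewrite enormN -/(e k).
  by have := gap k; have := mulr_ge0 G0 (e0 k); have := d0 k; lra.
(* The index shift reflects that only the iterates produced by a step satisfy optimality
   conditions. *)
have limit_eq0 (F : 'cV[R]_n * 'cV[R]_m -> R) (C : R) :
    continuous F -> (forall k, `|F (u k.+1, y k.+1)| <= C * (d k + e k)) ->
    F (ustar, ystar) = 0.
  move=> F_cont F_le; apply: (cluster_cvg_eq limit_point_uy).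
    exact: F_cont.
  by rewrite -(cvg_shiftS (fun k => F (u k, y k))); exact: cvg0_le F_le de_cvg0.
have cont_u k (P : 'M[R]_(k, n)) i :
    continuous (fun x : 'cV[R]_n * 'cV[R]_m => (P *m x.1) i 0).
  move=> x; apply: (@continuous_comp _ _ _ fst (fun v => (P *m v) i 0)).
    exact: cvg_fst.
  exact: mulmx_coord_continuous.
have cont_y i : continuous (fun x : 'cV[R]_n * 'cV[R]_m => x.2 i 0).
  move=> x; apply: (@continuous_comp _ _ _ snd (fun v : 'cV[R]_m => v i 0)).
    exact: cvg_snd.
  exact: coord_continuous.
have feas : W *m ustar = ystar.
  apply/colP => i; apply/eqP; rewrite -subr_eq0; apply/eqP.
  apply: (@limit_eq0 (fun x => (W *m x.1) i 0 - x.2 i 0) (G + 1)).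
    by move=> x; apply: cvgB; [exact: cont_u | exact: cont_y].
  move=> k /=; apply: le_trans (infeas k).
  have := normr_coord_le_enorm (W *m u k.+1 - y k.+1) i.
  by rewrite [(_ - y k.+1) i 0]mxE [(- y k.+1) i 0]mxE.
(* N g = 0 says g = W^T M g, which is the first KKT equation with multiplier - M g. *)
pose N : 'M[R]_n := 1%:M - W^T *m M.
have grad0 : N *m (H *m ustar - q) = 0.
  apply/colP => i; rewrite [RHS]mxE mulmxBr mulmxA mxE [X in _ + X]mxE.
  apply: (@limit_eq0 (fun x => (N *m H *m x.1) i 0 - (N *m q) i 0)
    (specnorm N * t)).
    by move=> x; apply: cvgB; [exact: cont_u | exact: cvg_cst].
  move=> k /=.
  have := u_step_projected_gradient W_full_row_rank (ustep k).
  rewrite -/H -/q -/M -/N => NE.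
  have -> : (N *m H *m u k.+1) i 0 - (N *m q) i 0
      = (N *m (H *m u k.+1 - q)) i 0.
    by rewrite mulmxBr (mulmxA N H) [RHS]mxE [X in _ = _ + X]mxE.
  rewrite NE; apply: (le_trans (normr_coord_le_enorm _ _)).
  rewrite enormN enormZ gtr0_norm//.
  have := enorm_mulmx_le N (u k.+1 - u k); rewrite -/(d k) => Nd.
  apply: (@le_trans _ _ (t * (specnorm N * d k))).
    by apply: ler_pM; [exact: ltW | exact: enorm_ge0 | exact: t_le | exact: Nd].
  rewrite mulrA (mulrC t) ler_wpM2l ?lerDl// mulr_ge0 ?specnorm_ge0//.
  exact: ltW.
(* The product form of complementarity is continuous, so it passes to the limit even if the support
   of y shrinks there. Along the iterates, either y_i = 0 or [y_step_stationary] expresses z_i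
   through vanishing residuals, while |y_i| <= K. *)
have compl i : ystar i 0 * (zmap A u0 W beta ustar) i 0 = 0.
  have zmi v : zmap A u0 W beta v i 0 = (- (M *m H) *m v) i 0 + (M *m q) i 0.
    by rewrite zmE mulmxBr opprB addrC (mulmxA M H) -mulNmx [LHS]mxE.
  rewrite zmi; apply: (@limit_eq0 (fun x => x.2 i 0 *
    ((- (M *m H) *m x.1) i 0 + (M *m q) i 0)) (K * (t + rho * (G + 1)))).
    move=> x; apply: cvgM; first exact: cont_y.
    by apply: cvgD; [exact: cont_u | exact: cvg_cst].
  move=> k /=; rewrite -zmi.
  have de0 : 0 <= d k + e k by rewrite addr_ge0.
  have [->|yi0] := eqVneq (y k.+1 i 0) 0.
    rewrite mul0r normr0 mulr_ge0// mulr_ge0//; nra.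
  rewrite (y_step_stationary (ystep k) yi0) normrM -mulrA.
  apply: ler_pM => //; rewrite mulrDl; apply: (le_trans (ler_normB _ _)).
  rewrite !normrM (gtr0_norm (t_gt0 k)) (gtr0_norm rho_gt0) -(mulrA rho).
  apply: lerD.
    apply: ler_pM => //; first exact: ltW.
    by apply: (le_trans (normr_coord_le_enorm _ _)); rewrite -/(e k) lerDr.
  rewrite ler_pM2l//; apply: le_trans (infeas k); exact: normr_coord_le_enorm.
exists (zmap A u0 W beta ustar); split.
- rewrite gradient_lsq zmE -/M mulmxN mulmxA.
  move: grad0; rewrite mulmxBl mul1mx => <-; congr (_ - _).
  by rewrite mulmxDl -scalemxAl !mulmxBr !mulmxA addrAC.
(* The subgradient is the multiplier itself; [compl] supplies the condition on the support. *)
- exists (zmap A u0 W beta ustar); last by rewrite subrr.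
  exact: l0norm_limiting_subgradient.
- by rewrite feas subrr.
Qed.
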